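(* Let $\mathbb{N}=\{1,2,3,\dots\}$, let $T:\mathbb{N}\to\mathbb{N}$ be the Collatz map $T(n)=n/2$ if $n$ is even and $T(n)=(3n+1)/2$ if $n$ is odd, and let $\mu$ be the counting measure on $(\mathbb{N},2^{\mathbb{N}})$. There exists a partition of $\mathbb{N}$ into three pairwise disjoint sets $C$, $D_1$, $D_2$ (with union $\mathbb{N}$) such that: (1) $C$ is the conservative part of $(\mathbb{N},2^{\mathbb{N}},T,\mu)$ given by the Hopf decomposition, and it is composed of at most countably many cycles $C_i$; the complement of $C$ (the dissipative part $D$) is partitioned into the two subsets $D_1$ and $D_2$. (2) $D_1=\left(\bigcup_{k=1}^{\infty}T^{-k}(C)\right)\setminus C$; it is the set of elements of $D$ which enter $C$, into one of the cycles $C_i$, after finitely many iterates of $T$. (3) $T^{-1}(C\cup D_1)=C\cup D_1$. (4) $D_2$ is the complement of $C\cup D_1$ in $\mathbb{N}$; it is the set of elements of $\mathbb{N}$ having an unbounded trajectory, and it is invariant, i.e. $T^{-1}(D_2)=D_2$.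
   Context: A cycle for $T$ is a set $\{a,Ta,\dots,T^{i-1}a\}$ with $a\in\mathbb{N}$, $T^ja\ne a$ for $1\le j\le i-1$, and $T^ia=a$. The trajectory of $n$ is the sequence $(T^k n)_k$; it is unbounded if the set $\{T^kn : k\in\mathbb{N}\}$ is unbounded. Hopf decomposition: $\mathbb{N}$ decomposes into disjoint sets $C$ (the conservative part) and $D=C^c$ (the dissipative part) such that $C\subset T^{-1}(C)$; the restriction of $T$ to $C$ is conservative, i.e. $T$ returns ($\mu$-a.e., here everywhere) infinitely often to every subset of $C$ of positive measure (in particular, for every $m\in C$ there is $k(m)\in\mathbb{N}$ with $T^{k(m)}(m)=m$); and $D$ is an at most countable union of wandering sets, where $W$ is wandering if $T^{-i}(W)\cap T^{-j}(W)=\emptyset$ for all $i\neq j$ in $\mathbb{N}$. The parts of the partition are allowed to be empty. *)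

(* Defs.v *)
From HB Require Import structures.
From mathcomp Require Import all_boot all_order all_algebra.
From mathcomp Require Import all_classical all_reals all_analysis.

Set Implicit Arguments.
Unset Strict Implicit.
Unset Printing Implicit Defensive.

Local Open Scope classical_set_scope.
Local Open Scope ring_scope.

(* The positive integers {1, 2, 3, ...} with the discrete sigma-algebra. *)
Definition posN : Type := {n : nat | (0 < n)%N}.

HB.instance Definition _ := Choice.on posN.
HB.instance Definition _ := isPointed.Build posN (exist _ 1%N isT).
HB.instance Definition _ := @isMeasurable.Build default_measure_display posN
  discrete_measurable discrete_measurable0
  discrete_measurableC discrete_measurableU.

Definition collatz_nat (n : nat) : nat :=
  if odd n then ((3 * n + 1) %/ 2)%N else (n %/ 2)%N.

Lemma collatz_nat_gt0 (n : nat) : (0 < n)%N -> (0 < collatz_nat n)%N.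
Proof.
rewrite /collatz_nat; case: n => [//|[|n]] _ //.
by case: ifP => _; rewrite divn_gt0// mulnS addn1.
Qed.

Definition collatz (n : posN) : posN :=
  exist _ (collatz_nat (sval n)) (collatz_nat_gt0 (svalP n)).

Section Dynamics.
Context {X : Type} (T : X -> X).

Definition is_cycle (A : set X) : Prop :=
  exists (a : X) (i : nat),
    [/\ (0 < i)%N,
        (forall j : nat, (1 <= j <= i.-1)%N -> iter j T a <> a),
        iter i T a = a &
        A = [set iter j T a | j in `I_i]].

End Dynamics.

Definition unbounded_trajectory (T : posN -> posN) (n : posN) : Prop :=
  ~ has_ubound (range (fun k : nat => sval (iter k T n))).

Section Hopf.
Context {d : measure_display} {X : measurableType d} {R : realType}.
Variables (T : X -> X) (mu : {measure set X -> \bar R}).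

(* The exponents range over {1, 2, 3, ...}; when T is surjective (as the
   Collatz map is) also allowing the exponent 0 gives the same notion. *)
Definition wandering (W : set X) : Prop :=
  measurable W /\
  forall i j : nat, (0 < i)%N -> (0 < j)%N -> i <> j ->
    iter i T @^-1` W `&` iter j T @^-1` W = set0.

Definition conservative_on (C : set X) : Prop :=
  forall A : set X, measurable A -> A `<=` C -> (0 < mu A)%E ->
    {ae mu, forall x, A x ->
      forall n : nat, exists2 k : nat, (n <= k)%N & A (iter k T x)}.

(* As the empty set is wandering, sequences of wandering sets cover the
   finite and empty unions too. *)
Definition hopf_decomposition (C D : set X) : Prop :=
  [/\ measurable C,
      D = ~` C,
      C `<=` T @^-1` C,
      conservative_on C &
      exists2 W : nat -> set X, (forall n, wandering (W n)) &
        D = \bigcup_n W n].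

End Hopf.

(* Main.v *)
Require Import Defs.
From HB Require Import structures.
From mathcomp Require Import all_boot all_order all_algebra.
From mathcomp Require Import all_classical all_reals all_analysis.

(** The argument is about the orbits of a self-map T of the positive integers,
    and is applied to the Collatz map.

    C is the set of periodic points.  Every point of C returns to itself
    infinitely often, so T is conservative on C (for the counting measure,
    almost everywhere recurrence is recurrence at each point).  Conversely, if
    the single point m is hit at two different times i < j by one trajectory,
    then T^(j-i) m = m; hence {m} is wandering as soon as m is not periodic,
    and the complement of C is a countable union of such singletons
    ([hopf_decomposition_periodic]).  The forward orbit of a periodic point is
    a cycle, and every cycle arises in this way, so C is the union of all
    cycles, and there are at most as many of them as there are integers.

    D1 and D2 separate the non-periodic points according to whether their
    trajectory meets C.  A trajectory with a repeated value meets C, and a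
    trajectory that meets C takes finitely many values.  A bounded trajectory
    repeats a value by the pigeonhole principle, so a trajectory is unbounded
    exactly when it never meets C ([unbounded_trajectoryE]).  The set of points
    whose trajectory meets C is completely invariant because C is mapped into
    itself, and so is its complement D2. *)

Set Implicit Arguments.
Unset Strict Implicit.
Unset Printing Implicit Defensive.

Local Open Scope classical_set_scope.
Local Open Scope ring_scope.

Definition periodic {X : Type} (T : X -> X) : set X :=
  [set x | exists2 p, (0 < p)%N & iter p T x = x].

Definition enters_periodic {X : Type} (T : X -> X) : set X :=
  [set x | exists k, periodic T (iter k T x)].

Definition forward_orbit {X : Type} (T : X -> X) (x : X) : set X :=
  range (fun k => iter k T x).

(** * Periodic points and cycles *)

Lemma iter_mul_period {X : Type} (T : X -> X) x p n :
  iter p T x = x -> iter (n * p) T x = x.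
Proof. by move=> px; elim: n => // n IHn; rewrite mulSn iterD IHn. Qed.

Lemma iter_mod_period {X : Type} (T : X -> X) x p n :
  iter p T x = x -> iter n T x = iter (n %% p) T x.
Proof.
by move=> px; rewrite {1}(divn_eq n p) addnC iterD iter_mul_period.
Qed.

Lemma periodic_map {X : Type} (T : X -> X) : periodic T `<=` T @^-1` periodic T.
Proof. by move=> x [p p0 px]; exists p => //; rewrite -iterSr iterS px. Qed.

Lemma periodic_iter {X : Type} (T : X -> X) k x :
  periodic T x -> periodic T (iter k T x).
Proof. by move=> px; elim: k => // k IHk; exact: periodic_map. Qed.

Lemma iter_eq_periodic {X : Type} (T : X -> X) i j x : (i < j)%N ->
  iter i T x = iter j T x -> periodic T (iter i T x).
Proof.
move=> ij eij; exists (j - i)%N; first by rewrite subn_gt0.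
by rewrite -iterD subnK ?(ltnW ij).
Qed.

Lemma forward_orbit_period {X : Type} (T : X -> X) x p : (0 < p)%N ->
  iter p T x = x -> forward_orbit T x = [set iter j T x | j in `I_p].
Proof.
move=> p0 px; apply/seteqP; split=> y [k _ <-]; last by exists k.
by exists (k %% p)%N; [rewrite /= ltn_mod | rewrite -iter_mod_period].
Qed.

(** The definition of a cycle asks that its length be the least period, which
    a periodic point has because the natural numbers are well-ordered. *)
Lemma is_cycleE {X : Type} (T : X -> X) :
  is_cycle T = [set forward_orbit T x | x in periodic T].
Proof.
apply/seteqP; split=> [A [a [i [i0 _ ai ->]]]|_ [x [p p0 px] <-]].
  by exists a; [exists i | rewrite (forward_orbit_period i0 ai)].
have exP : exists q, (0 < q)%N && `[< iter q T x = x >].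
  by exists p; rewrite p0; apply/asboolP.
case: (ex_minnP exP) => q /andP[q0 /asboolP qx] qmin.
exists x, q; split => //; last exact: forward_orbit_period.
move=> j /andP[j0 jq] jx.
have /qmin : (0 < j)%N && `[< iter j T x = x >] by rewrite j0; apply/asboolP.
by rewrite leqNgt -{1}(prednK q0) ltnS jq.
Qed.

Lemma bigcup_cycles {X : Type} (T : X -> X) :
  \bigcup_(A in is_cycle T) A = periodic T.
Proof.
rewrite is_cycleE bigcup_image; apply/seteqP; split=> [y [x px [k _ <-]]|x px].
  exact: periodic_iter.
by exists x => //; exists 0%N.
Qed.

Lemma countable_posN (A : set posN) : countable A.
Proof. by apply/countable_injP; exists sval => x y _ _; exact: val_inj. Qed.

(** Distinct cycles are forward orbits of distinct points, hence can be counted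
    by their base points. *)
Lemma countable_cycles (T : posN -> posN) : countable (is_cycle T).
Proof.
by rewrite is_cycleE; apply: sub_countable (card_image_le _ _) (countable_posN _).
Qed.

(** * Hopf decomposition *)

(** A point of both preimages would have a trajectory visiting the same
    non-periodic point at two times.  Allowing W to be empty lets the integers
    index a cover of the non-periodic points. *)
Lemma wandering_sub_singleton (T : posN -> posN) (W : set posN) :
  is_subset1 W -> W `<=` ~` periodic T -> wandering T W.
Proof.
move=> W1 Wnp; split => // i j _ _.
wlog ij : i j / (i < j)%N => [hw nij|_].
  case: (ltngtP i j) => // ij; first exact: hw.
  by rewrite setIC; apply: hw => // /esym.
rewrite -subset0 => x [/= Wi Wj].
exact: (Wnp _ Wi (iter_eq_periodic ij (W1 _ _ Wi Wj))).
Qed.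

(** Multiples of the period are arbitrarily late return times. *)
Lemma conservative_on_periodic (R : realType) (T : posN -> posN) :
  conservative_on T (@counting posN R) (periodic T).
Proof.
move=> A _ AC _; apply: aeW => x Ax n; have [p p0 px] := AC _ Ax.
by exists (n * p)%N; [exact: leq_pmulr | rewrite iter_mul_period].
Qed.

Lemma hopf_decomposition_periodic (R : realType) (T : posN -> posN) :
  hopf_decomposition T (@counting posN R) (periodic T) (~` periodic T).
Proof.
split => //; [exact: periodic_map | exact: conservative_on_periodic |].
exists (fun n => [set x | sval x = n] `\` periodic T) => [n|].
  apply: wandering_sub_singleton => [x y [/= xn _] [/= yn _]|x []//].
  by apply: val_inj; rewrite /= xn yn.
by apply/seteqP; split=> [x px|x [n _ []//]]; exists (sval x).
Qed.

(** * Trajectories that reach a periodic point *)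

Lemma enters_periodic_preimage {X : Type} (T : X -> X) :
  T @^-1` enters_periodic T = enters_periodic T.
Proof.
apply/seteqP; split=> x [k]; first by rewrite -iterSr; exists k.+1.
by move=> pk; exists k; rewrite -iterSr; exact: periodic_map.
Qed.

(** From time k on, only the time elapsed since k modulo p matters. *)
Lemma iter_preperiod {X : Type} (T : X -> X) x k p m : (0 < p)%N ->
  iter p T (iter k T x) = iter k T x ->
  exists2 m', (m' < k + p)%N & iter m T x = iter m' T x.
Proof.
move=> p0 px; have [mk|km] := ltnP m k.
  by exists m => //; exact: ltn_addr.
exists ((m - k) %% p + k)%N; first by rewrite addnC ltn_add2l ltn_mod.
by rewrite -{1}(subnK km) !iterD -iter_mod_period.
Qed.

(** The pigeonhole principle: otherwise infinitely many distinct values would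
    lie in an initial segment of the integers. *)
Lemma bounded_trajectory_enters (T : posN -> posN) x :
  has_ubound (range (fun k => sval (iter k T x))) -> enters_periodic T x.
Proof.
move=> [M ubM]; apply: contrapT => npx.
pose f (k : 'I_M.+2) : 'I_M.+1 := inord (sval (iter k T x)).
have /leq_card : injective f.
  have fval k : f k = sval (iter k T x) :> nat.
    by rewrite inordK // ltnS; apply: ubM; exists (k : nat).
  have neq (i j : 'I_M.+2) : (i < j)%N -> iter i T x <> iter j T x.
    by move=> ij eij; apply: npx; exists i; exact: iter_eq_periodic eij.
  move=> i j /(congr1 val) /=; rewrite !fval => /val_inj eij.
  by apply/val_inj; case: (ltngtP i j) => // /neq; rewrite eij.
by rewrite !card_ord ltnn.
Qed.

Lemma enters_bounded_trajectory (T : posN -> posN) x :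
  enters_periodic T x -> has_ubound (range (fun k => sval (iter k T x))).
Proof.
move=> [k [p p0 px]]; exists (\max_(i < k + p) sval (iter i T x))%N.
move=> _ [m _ <-]; have [m' m'kp ->] := iter_preperiod m p0 px.
exact: (leq_bigmax (Ordinal m'kp)).
Qed.

Lemma unbounded_trajectoryE (T : posN -> posN) :
  [set x | unbounded_trajectory T x] = ~` enters_periodic T.
Proof.
apply/seteqP; split=> x /= h e; apply: h.
  exact: enters_bounded_trajectory.
exact: bounded_trajectory_enters.
Qed.

Theorem theorem3p1 (R : realType) :
  exists C D1 D2 : set posN,
    [/\ C `&` D1 = set0, C `&` D2 = set0, D1 `&` D2 = set0 &
        C `|` D1 `|` D2 = setT] /\
    exists Cs : set (set posN),
      [/\ (* (1) *)
          [/\ hopf_decomposition collatz (@counting posN R) C (~` C),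
              countable Cs,
              (forall A : set posN, Cs A -> is_cycle collatz A),
              C = \bigcup_(A in Cs) A &
              ~` C = D1 `|` D2],
          (* (2) *)
          D1 = (\bigcup_(k in [set k : nat | (1 <= k)%N])
                  (iter k collatz @^-1` C)) `\` C /\
          D1 = [set n | (~` C) n /\
                  exists (k : nat) (A : set posN),
                    Cs A /\ A (iter k collatz n)],
          (* (3) *)
          collatz @^-1` (C `|` D1) = C `|` D1 &
          (* (4) *)
          [/\ D2 = ~` (C `|` D1),
              D2 = [set n | unbounded_trajectory collatz n] &
              collatz @^-1` D2 = D2]].
Proof.
pose C := periodic collatz; pose E := enters_periodic collatz.
have CE : C `<=` E by move=> x Cx; exists 0%N.
have CUD1 : C `|` E `\` C = E by exact: setDUK.
have D1E : E `\` C = (\bigcup_(k in [set k : nat | (1 <= k)%N])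
                        (iter k collatz @^-1` C)) `\` C.
  apply/seteqP; split=> x [].
    by move=> [[|k] Ck] nCx; [| split => //; exists k.+1].
  by move=> [k _ Ck] nCx; split => //; exists k.
exists C, (E `\` C), (~` E); split.
  split; [exact: setDIK | | | by rewrite CUD1 setUv].
    by apply/disjoints_subset; rewrite setCK.
  by apply/disjoints_subset; rewrite setCK; exact: subDsetl.
exists (is_cycle collatz); rewrite CUD1; split.
- split=> //; [exact: hopf_decomposition_periodic | exact: countable_cycles | |].
    by rewrite bigcup_cycles.
  apply/seteqP; split=> x.
    by move=> nCx; have [Ex|nEx] := pselect (E x); [left | right].
  by move=> [[]//|nEx /CE].
- split=> //; apply/seteqP; split=> x [].
    move=> [k]; rewrite /C -bigcup_cycles => -[A cA Ak] nCx.
    by split=> //; exists k, A.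
  move=> nCx [k [A [cA Ak]]]; split=> //; exists k.
  by rewrite -bigcup_cycles; exists A.
- exact: enters_periodic_preimage.
- split=> //; first by rewrite unbounded_trajectoryE.
  by rewrite -preimage_setC enters_periodic_preimage.
Qed.
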